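(* Let $(X,\mathcal{F},\mu)$ be a charge space, $(Y,\mathcal{U})$ a uniform space (equipped with its uniform topology), and $f : X \rightarrow Y$ a function. 1. $f$ is $T_1$-measurable if and only if $f$ is $T_2$-measurable. If either holds, then $f$ is smooth. 2. Suppose $\mathcal{F}$ is a $\sigma$-field and $f$ is conventionally measurable. Then: (a) $f$ is uniformly base measurable; (b) if $\mu$ is a bounded (countably additive) measure and $Y$ is Lindelöf, then $f$ is $T_2$-measurable. 3. Suppose $(X,\mathcal{F},\mu)$ is a complete measure space and $Y$ is hereditarily Lindelöf. If either (a) $f$ is base measurable, or (b) $f$ is $T_2$-measurable, then $f$ is conventionally measurable. 4. If $f$ is uniformly base measurable then $f$ is base measurable. The converse holds if $Y$ is uniformly locally compact. 5. If $f$ is uniformly base measurable and smooth, then $f$ is $T_2$-measurable.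
   Context: A charge space $(X,\mathcal{F},\mu)$ is a set $X$, a field (algebra) $\mathcal{F}$ of subsets of $X$, and a positive charge $\mu:\mathcal{F}\to[0,\infty]$, i.e. a finitely additive set function with $\mu(\emptyset)=0$; $\mu$ is bounded if $\mu(X)<\infty$, and may be unbounded. A measure space is a charge space in which $\mathcal{F}$ is a $\sigma$-field and $\mu$ is countably additive; it is complete if every subset of a set of measure zero belongs to $\mathcal{F}$. The outer charge is $\mu^*(A)=\inf\{\mu(B): B\in\mathcal{F}, B\supseteq A\}$ for $A\subseteq X$. The Peano-Jordan completion $\overline{\mathcal{F}}$ is the field of all $A\subseteq X$ such that for every $\epsilon>0$ there are $B,C\in\mathcal{F}$ with $B\subseteq A\subseteq C$ and $\mu(C\setminus B)<\epsilon$. For $E\subseteq Y\times Y$ and $y\in Y$, $E[y]=\{y'\in Y:(y,y')\in E\}$. Entourages are the elements of $\mathcal{U}$; an entourage base is a subset $\mathcal{B}\subseteq\mathcal{U}$ such that each entourage contains an element of $\mathcal{B}$. $Y$ is uniformly locally compact if there is an entourage $D$ such that $D[y]$ is compact for all $y\in Y$. A simple function $s:X\to Y$ is a function with finitely many values such that $s^{-1}(\{b\})\in\mathcal{F}$ for each $b\in Y$. Neighbourhoods need not be open. Sets in a ''partition'' may be empty. A function $f:X\to Y$ is: - conventionally measurable (when $\mathcal{F}$ is a $\sigma$-field) if $f^{-1}(U)\in\mathcal{F}$ for every open $U\subseteq Y$; - $T_1$-measurable if for every $\epsilon>0$ and every entourage $E$ there is a simple function $s$ with $\mu^*(\{x\in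 X:(s(x),f(x))\notin E\})<\epsilon$; - $T_2$-measurable if for every $\epsilon>0$ and every entourage $E$ there is a partition of $X$ into sets $A_0,A_1,\ldots,A_n\in\mathcal{F}$ such that $\mu(A_0)<\epsilon$ and $f(A_i)\times f(A_i)\subseteq E$ for each $i\in\{1,\ldots,n\}$; - smooth if for every $\epsilon>0$ and every entourage $E$ there are finitely many sets $B_1,\ldots,B_n\subseteq Y$ with $B_i\times B_i\subseteq E$ for each $i$ and $\mu^*(\{x\in X: f(x)\notin\bigcup_{i=1}^n B_i\})<\epsilon$; - base measurable if each $y\in Y$ has a neighbourhood base $\mathcal{B}_y$ (in the uniform topology) such that $f^{-1}(B)\in\overline{\mathcal{F}}$ for all $B\in\mathcal{B}_y$; - uniformly base measurable if there is an entourage base $\mathcal{B}\subseteq\mathcal{U}$ such that $f^{-1}(E[y])\in\overline{\mathcal{F}}$ for all $E\in\mathcal{B}$ and $y\in Y$. *)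

(* Defs.v *)
From HB Require Import structures.
From mathcomp Require Import all_boot all_order all_algebra.
From mathcomp Require Import all_classical all_reals all_analysis.

Set Implicit Arguments.
Unset Strict Implicit.
Unset Printing Implicit Defensive.
Import Order.TTheory GRing.Theory Num.Theory.
Import numFieldNormedType.Exports.
Local Open Scope classical_set_scope.
Local Open Scope ring_scope.
Local Open Scope ereal_scope.

(* The library's algebraOfSetsType and {content set _ -> \bar _} force the
   carrier to be pointed, and a bundled type carries a single set system; here
   the carrier may be empty and the field F is explicit. The charge mu is a
   total function, but only its values on F are constrained or used. *)
Section charge_spaces.
Context {R : realType} {X : Type}.
Implicit Types (F : set (set X)) (mu : set X -> \bar R).

Definition set_field F := [/\ F set0, setC_closed F & setU_closed F].

Definition positive_charge F mu :=
  [/\ mu set0 = 0,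
      forall A, F A -> 0 <= mu A &
      forall A B, F A -> F B -> A `&` B = set0 ->
        mu (A `|` B) = mu A + mu B].

Definition charge_space F mu := set_field F /\ positive_charge F mu.

Definition countably_additive F mu :=
  forall A : (set X)^nat, (forall n, F (A n)) -> trivIset setT A ->
    F (\bigcup_n A n) ->
    (fun n => \sum_(0 <= i < n) mu (A i)) @ \oo --> mu (\bigcup_n A n).

Definition measure_space F mu :=
  [/\ charge_space F mu, sigma_algebra setT F & countably_additive F mu].

Definition complete_measure_space F mu :=
  measure_space F mu /\
  (forall N A, F N -> mu N = 0 -> A `<=` N -> F A).

Definition bounded_charge mu := mu setT < +oo.

Definition outer_charge F mu (A : set X) : \bar R :=
  ereal_inf [set mu B | B in [set B | F B /\ A `<=` B]].

Definition peano_jordan F mu : set (set X) :=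
  [set A | forall eps : R, (0 < eps)%R ->
     exists B C, [/\ F B, F C, B `<=` A, A `<=` C & mu (C `\` B) < eps%:E]].

End charge_spaces.

Definition lindelof (T : topologicalType) :=
  forall C : set (set T), C `<=` open -> \bigcup_(U in C) U = setT ->
    exists D : set (set T),
      [/\ D `<=` C, countable D & \bigcup_(U in D) U = setT].

(* set_type A carries the subspace topology, i.e. the initial topology for the
   inclusion of A. *)
Definition hereditarily_lindelof (T : topologicalType) :=
  forall A : set T, lindelof (set_type A).

Definition neighbourhood_base (T : topologicalType) (y : T)
    (B : set (set T)) :=
  B `<=` nbhs y /\ forall N, nbhs y N -> exists2 V, B V & V `<=` N.

Definition entourage_base (Y : uniformType) (B : set (set (Y * Y))) :=
  B `<=` entourage /\ forall E, entourage E -> exists2 V, B V & V `<=` E.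

Definition uniformly_locally_compact (Y : uniformType) :=
  exists2 D : set (Y * Y), entourage D & forall y, compact (xsection D y).

Section measurability.
Context {R : realType} {X : Type} {Y : uniformType}.
Variables (F : set (set X)) (mu : set X -> \bar R).
Implicit Types (f s : X -> Y) (E : set (Y * Y)).

Definition simple_function s :=
  finite_set (range s) /\ forall b, F (s @^-1` [set b]).

Definition conventionally_measurable f :=
  forall U : set Y, open U -> F (f @^-1` U).

Definition T1_measurable f :=
  forall (eps : R) E, (0 < eps)%R -> entourage E ->
    exists2 s, simple_function s &
      outer_charge F mu [set x | ~ E (s x, f x)] < eps%:E.

Definition T2_measurable f :=
  forall (eps : R) E, (0 < eps)%R -> entourage E ->
    exists n (A : 'I_n.+1 -> set X),
      [/\ trivIset setT A, \bigcup_i A i = setT, forall i, F (A i),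
          mu (A ord0) < eps%:E &
          forall i, i != ord0 -> (f @` A i) `*` (f @` A i) `<=` E].

Definition smooth f :=
  forall (eps : R) E, (0 < eps)%R -> entourage E ->
    exists n (B : 'I_n -> set Y),
      (forall i, B i `*` B i `<=` E) /\
      outer_charge F mu [set x | ~ (\bigcup_i B i) (f x)] < eps%:E.

Definition base_measurable f :=
  forall y : Y, exists2 B : set (set Y), neighbourhood_base y B &
    forall V, B V -> peano_jordan F mu (f @^-1` V).

Definition uniformly_base_measurable f :=
  exists2 B : set (set (Y * Y)), entourage_base B &
    forall E y, B E -> peano_jordan F mu (f @^-1` xsection E y).

End measurability.

(* Main.v *)
Require Import Defs.
From HB Require Import structures.
From mathcomp Require Import all_boot all_order all_algebra.
From mathcomp Require Import all_classical all_reals all_analysis.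

Set Implicit Arguments.
Unset Strict Implicit.
Unset Printing Implicit Defensive.
Import Order.TTheory GRing.Theory Num.Theory.
Import numFieldNormedType.Exports.
Local Open Scope classical_set_scope.
Local Open Scope ring_scope.
Local Open Scope ereal_scope.

(** T2 measurability asks to cover X, up to a set of small charge, by finitely
    many members of F on which f varies little. The cover has to be disjoint,
    but disjointifying costs nothing (T2_measurable_cover). The level sets of a
    simple function close to f give such a cover. Conversely, a simple function takes on each piece
    the value of f at one point of the piece. Smoothness is the same condition
    on the images, without measurability of the pieces. Uniform base
    measurability restores it: the small sets of the definition of smoothness
    lie in sections E[y], and preimages of such sections are approximated from
    inside by members of F (smooth_T2_measurable).

    For a conventionally measurable f, the entourages with open sections form
    an entourage base, which gives uniform base measurability. If Y is also
    Lindelof, then countably many small open sets cover Y, and for a bounded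
    measure finitely many of them have preimages that exhaust X up to small
    charge (charge_small_tail). So f is smooth, hence T2 measurable.

    In the other direction, base and T2 measurability both give, around each
    point y of an open set U, a neighbourhood V whose preimage is covered, up to
    arbitrarily small charge, by a member of F inside the preimage of U. In a
    complete measure space this error can be absorbed
    (complete_small_cover), and the hereditary Lindelof property reduces U to
    countably many such V (complete_conventionally_measurable).

    Finally, base measurability only controls unspecified neighbourhoods of each
    single point. When sections of some entourage are compact, the compact
    closure of a smaller section W[y] is covered by finitely many of these
    neighbourhoods inside E[y]. Their union contains W[y], so the sets
    obtained are the sections of an entourage
    (base_uniformly_base_measurable). *)

(** * Fields of sets and charges *)

Section fields.
Context {X : Type} {F : set (set X)} (hF : set_field F).

Lemma field_set0 : F set0. Proof. by case: hF. Qed.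

Lemma field_setU A B : F A -> F B -> F (A `|` B).
Proof. by case: hF => _ _; exact. Qed.

Lemma field_setC A : F A -> F (~` A).
Proof. by case: hF => _ + _; exact. Qed.

Lemma field_setI A B : F A -> F B -> F (A `&` B).
Proof.
move=> FA FB; rewrite -(setCK (A `&` B)) setCI.
by apply/field_setC/field_setU; exact: field_setC.
Qed.

Lemma field_setD A B : F A -> F B -> F (A `\` B).
Proof. by move=> FA FB; rewrite setDE; apply/field_setI/field_setC. Qed.

Lemma field_bigsetU (I : Type) (r : seq I) (G : I -> set X) :
  (forall i, F (G i)) -> F (\big[setU/set0]_(i <- r) G i).
Proof.
by move=> FG; apply: big_ind => //; [exact: field_set0|exact: field_setU].
Qed.

Lemma field_finite_bigcup (I : choiceType) (D : set I) (G : I -> set X) :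
  finite_set D -> (forall i, F (G i)) -> F (\bigcup_(i in D) G i).
Proof.
by move=> /finite_seqP[r ->] FG; rewrite bigcup_seq; exact: field_bigsetU.
Qed.

End fields.

Section sigma_fields.
Context {X : Type} {F : set (set X)} (sF : sigma_algebra setT F).

Lemma sigma_field_bigcup (A : (set X)^nat) :
  (forall n, F (A n)) -> F (\bigcup_n A n).
Proof. by case: sF => _ _; exact. Qed.

Lemma sigma_field_bigcap (A : (set X)^nat) :
  (forall n, F (A n)) -> F (\bigcap_n A n).
Proof.
move=> FA; case: sF => _ FC FU.
rewrite -(setCK (\bigcap_n A n)) setC_bigcap -setTD; apply: (FC).
by apply: FU => n; rewrite -setTD; exact: FC.
Qed.

End sigma_fields.

Section charges.
Context {R : realType} {X : Type} {F : set (set X)} {mu : set X -> \bar R}.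
Hypothesis hmu : charge_space F mu.

Let hF : set_field F. Proof. by case: hmu. Qed.

Lemma charge_set0 : mu set0 = 0. Proof. by case: hmu => _ []. Qed.

Lemma charge_ge0 A : F A -> 0 <= mu A.
Proof. by case: hmu => _ [_ + _]; exact. Qed.

Lemma chargeU A B : F A -> F B -> A `&` B = set0 -> mu (A `|` B) = mu A + mu B.
Proof. by case: hmu => _ [_ _]; exact. Qed.

Lemma le_charge A B : F A -> F B -> A `<=` B -> mu A <= mu B.
Proof.
move=> FA FB AB; rewrite -(setDUK AB) chargeU ?setDIK//.
  by rewrite leeDl// charge_ge0//; exact: field_setD.
exact: field_setD.
Qed.


Lemma charge_setU_le A B : F A -> F B -> mu (A `|` B) <= mu A + mu B.
Proof.
move=> FA FB; have FBA := field_setD hF FB FA.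
rewrite -(setDUK (@subsetUl _ A B)) setDUD setDv set0U chargeU ?setDIK//.
by apply: leeD => //; exact: le_charge.
Qed.

Lemma charge_bigsetU_le (I : Type) (r : seq I) (G : I -> set X) :
  (forall i, F (G i)) ->
  mu (\big[setU/set0]_(i <- r) G i) <= \sum_(i <- r) mu (G i).
Proof.
move=> FG; elim: r => [|i r IH]; first by rewrite !big_nil charge_set0.
rewrite !big_cons; apply: (le_trans (charge_setU_le _ _)) => //.
  exact: field_bigsetU.
exact: leeD.
Qed.

Lemma charge_bigsetU (A : (set X)^nat) n :
  (forall i, F (A i)) -> trivIset setT A ->
  mu (\big[setU/set0]_(i < n) A i) = \sum_(0 <= i < n) mu (A i).
Proof.
move=> FA tA; elim: n => [|n IH]; first by rewrite big_ord0 big_nil charge_set0.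
rewrite big_ord_recr big_nat_recr//= chargeU ?IH//; first exact: field_bigsetU.
apply/seteqP; split=> // x []; rewrite -bigcup_mkord => -[i /= iltn Aix Anx].
have eqin : i = n by apply: tA => //; exists x.
by move: iltn; rewrite eqin ltnn.
Qed.

Lemma outer_charge_ltP A (e : \bar R) :
  outer_charge F mu A < e <-> exists B, [/\ F B, A `<=` B & mu B < e].
Proof.
split=> [/ereal_inf_lt[_ [B [FB AB] <-] Be]|[B [FB AB]]]; first by exists B.
by apply: le_lt_trans; apply: ereal_inf_lbound; exists B.
Qed.

Lemma peano_jordan_field A : F A -> peano_jordan F mu A.
Proof.
by move=> FA eps eps0; exists A, A; split=> //; rewrite setDv charge_set0.
Qed.

Lemma peano_jordanU A B : peano_jordan F mu A -> peano_jordan F mu B ->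
  peano_jordan F mu (A `|` B).
Proof.
move=> pA pB eps eps0; have eps20 : (0 < eps / 2)%R by rewrite divr_gt0.
have [A1 [A2 [FA1 FA2 A1A AA2 ltA]]] := pA _ eps20.
have [B1 [B2 [FB1 FB2 B1B BB2 ltB]]] := pB _ eps20.
exists (A1 `|` B1), (A2 `|` B2); split.
- exact: field_setU.
- exact: field_setU.
- exact: setUSS.
- exact: setUSS.
- have FA := field_setD hF FA2 FA1; have FB := field_setD hF FB2 FB1.
  rewrite (splitr eps) EFinD; apply: le_lt_trans (lteD ltA ltB).
  apply: le_trans (charge_setU_le FA FB).
  apply: le_charge; [|exact: field_setU|].
    by apply: field_setD => //; exact: field_setU.
  by move=> x [[A2x|B2x] /not_orP[nA nB]]; [left|right].
Qed.

(** Countable additivity makes a bounded charge continuous from below: the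
    disjointified pieces of the sequence have total mass mu X, so the part of
    X missed by the first n sets loses all its mass as n grows. *)
Lemma charge_small_tail (A : (set X)^nat) (eps : R) :
  sigma_algebra setT F -> bounded_charge mu -> countably_additive F mu ->
  (forall n, F (A n)) -> \bigcup_n A n = setT -> (0 < eps)%R ->
  exists n, mu (~` \bigcup_(i < n) A i) < eps%:E.
Proof.
move=> sF bmu cmu FA AT eps0.
have FD n : F (seqDU A n) by apply: field_setD => //; exact: field_bigsetU.
have FU n : F (\bigcup_(i < n) A i).
  by rewrite bigcup_mkord; exact: field_bigsetU.
have FT : F setT by rewrite -AT; exact: sigma_field_bigcup.
have muT : mu setT \is a fin_num.
  by rewrite ge0_fin_numE// charge_ge0.
have := cmu _ FD (@trivIset_seqDU _ A).
rewrite -seqDU_bigcup_eq AT => /(_ FT) cvT.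
have : nbhs (mu setT) [set y | mu setT - eps%:E < y].
  rewrite -(fineK muT) -EFinB.
  apply: (@nbhs_open_ereal_gt _ _ (fun x => x - eps)%R).
  by rewrite ltrBlDr ltrDl.
move=> /cvT [n _ /(_ n (leqnn n))] /=.
rewrite -(charge_bigsetU _ FD (@trivIset_seqDU _ A)).
rewrite -bigsetU_seqDU -bigcup_mkord => lt_n; exists n.
rewrite ltNge; apply/negP => le_eps.
have splitT : mu setT = mu (\bigcup_(i < n) A i) + mu (~` \bigcup_(i < n) A i).
  by rewrite -chargeU ?setUv ?setICr//; exact: field_setC.
have finU : mu (\bigcup_(i < n) A i) \is a fin_num.
  rewrite ge0_fin_numE ?charge_ge0//.
  by apply: le_lt_trans bmu; exact: le_charge.
move: lt_n; rewrite EFinN lteBlDr// splitT lteD2lE// => /(le_lt_trans le_eps).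
by rewrite ltxx.
Qed.

(** A subset of sets of arbitrarily small charge lies in a null set, namely
    the intersection of countably many of them. *)
Lemma complete_small_cover A : complete_measure_space F mu ->
  (forall eps : R, (0 < eps)%R -> exists N, [/\ F N, A `<=` N & mu N < eps%:E]) ->
  F A.
Proof.
move=> [[_ sF _] cF] small.
have /choice[N N_small] : forall m : nat, exists N,
    [/\ F N, A `<=` N & mu N < (m.+1%:R^-1 : R)%:E].
  by move=> m; apply: small; rewrite invr_gt0.
have FN m : F (N m) by case: (N_small m).
have FNI : F (\bigcap_m N m) by exact: sigma_field_bigcap.
apply: (cF _ _ FNI); last by move=> x Ax m _; case: (N_small m) => _ + _; exact.
apply/eqP; rewrite eq_le charge_ge0// andbT.
apply/lee_addgt0Pr => e e0; rewrite add0e.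
have [m _ /(_ m (leqnn m)) /= lt_e] := near_infty_natSinv_lt (PosNum e0).
apply: (@le_trans _ _ (mu (N m))); first by apply: le_charge => // x; exact.
case: (N_small m) => _ _ /ltW /le_trans; apply.
by rewrite lee_fin ltW.
Qed.

End charges.

(** * Uniform spaces, compactness and Lindelof spaces *)

Section uniform_spaces.
Context {Y : uniformType}.
Implicit Types (E : set (Y * Y)) (y : Y).

Lemma entourage_small_sections E : entourage E -> exists2 V : set (Y * Y),
  entourage V & forall y, xsection V y `*` xsection V y `<=` E.
Proof.
move=> entE; exists (split_ent E `&` (split_ent E)^-1)%relation.
  exact: entourage_invI.
move=> y [u v] /= [/xsectionP[_ yu] /xsectionP[yv _]].
exact: entourage_split yu yv.
Qed.

(** Passing to the interior of each section keeps an entourage: if the square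
    of W is inside E, then W[y] consists of points z with W[z] inside E[y]. *)
Lemma entourage_open_sections E : entourage E -> exists2 V : set (Y * Y),
  entourage V & V `<=` E /\ forall y, open (xsection V y).
Proof.
move=> entE; pose V := [set p : Y * Y | (xsection E p.1)^° p.2].
have sectV y : xsection V y = (xsection E y)^°.
  by apply/seteqP; split=> z; rewrite xsectionP.
exists V; last split=> [[y z] /interior_subset/xsectionP//|y].
  apply: (filterS _ (entourage_split_ent entE)) => -[y z] yz.
  apply: (filterS _ (nbhs_entourage z (entourage_split_ent entE))).
  move=> w /xsectionP zw; apply/xsectionP.
  exact: entourage_split yz zw.
by rewrite sectV; exact: open_interior.
Qed.

Lemma nbhs_xsection y (N : set Y) : nbhs y N ->
  exists2 E, entourage E & xsection E y `<=` N.
Proof. by rewrite -filter_from_entourageE => -[E]; exists E. Qed.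

End uniform_spaces.

(** Finite covers in disguise: the members of the directed family S that
    contain a given one form a filter base, and near-covering compactness
    along this filter yields one member that contains all of K. *)
Lemma compact_directed_cover (T : topologicalType) (K : set T)
    (S : set (set T)) : compact K -> S set0 ->
  (forall U V, S U -> S V -> S (U `|` V)) ->
  (forall z, K z -> exists2 V, S V & nbhs z V) ->
  exists2 V, S V & K `<=` V.
Proof.
move=> cK S0 SU Sz.
pose G := filter_from S (fun V => [set W | S W /\ V `<=` W]).
have FG : Filter G.
  apply: filter_from_filter; first by exists set0.
  move=> U V SUU SV; exists (U `|` V); first exact: SU.
  by move=> W [SW UVW]; split; split=> // x ?; apply: UVW; [left|right].
move/compact_near_coveringP: cK => /(_ _ G (fun V z => V z) FG).
case=> [z /Sz[V SV zV]|V SV VK]; last first.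
  by exists V => //; exact: (VK V (conj SV (@subset_refl _ V))).
exists (V, [set W | S W /\ V `<=` W]); first by split=> //; exists V.
by move=> [x W] /= [Vx [_ ?]]; auto.
Qed.

Lemma lindelof_sequence_cover (T : topologicalType) (S : set (set T)) :
  lindelof T -> S set0 -> (forall x : T, exists2 V, S V & nbhs x V) ->
  exists2 V : (set T)^nat, (forall n, S (V n)) & \bigcup_n V n = setT.
Proof.
move=> lT S0 Sx; pose C := [set V^° | V in S].
have [||D [DC cD DT]] := lT C.
- by move=> _ [V _ <-]; exact: open_interior.
- apply/seteqP; split=> // x _; have [V SV xV] := Sx x.
  by exists V^°; [exists V|].
have /choice[g gP] : forall W, exists V, D W -> S V /\ W `<=` V.
  move=> W; have [/DC[V SV <-]|nDW] := pselect (D W); last by exists set0.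
  by exists V => _; split=> //; exact: interior_subset.
have /countable_injP[h h_inj] := cD.
(* h numbers D, so the n-th union has at most one term *)
exists (fun n => \bigcup_(W in [set W | D W /\ h W = n]) g W).
  move=> n; have [[W [DW hW]]|none] := pselect (exists W, D W /\ h W = n).
    rewrite (_ : [set _ | _] = [set W]) ?bigcup_set1; first by case: (gP W DW).
    apply/seteqP; split=> [W' [DW' hW']|_ ->//].
    by apply: h_inj; rewrite ?inE// hW.
  rewrite (_ : [set _ | _] = set0) ?bigcup_set0//.
  by apply/seteqP; split=> // W DhW; apply: none; exists W.
apply/seteqP; split=> // x _; have : setT x by [].
rewrite -DT => -[W DW Wx]; exists (h W) => //; exists W => //.
by have [_] := gP W DW; exact.
Qed.

(** The members of S are pulled back to the subspace U and pushed forward again.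
    This keeps them in S because S is closed under subsets. *)
Lemma hereditarily_lindelof_sequence_cover (T : topologicalType) (U : set T)
    (S : set (set T)) : hereditarily_lindelof T ->
  (forall V W, S W -> V `<=` W -> S V) -> S set0 ->
  (forall x : T, U x -> exists2 V, S V & nbhs x V) ->
  exists2 V : (set T)^nat, (forall n, S (V n)) & U `<=` \bigcup_n V n.
Proof.
move=> hlT Ssub S0 Sx.
pose S' := [set V : set (set_type U) | S (set_val @` V)].
have [||V SV VT] := @lindelof_sequence_cover _ S' (hlT U).
- by rewrite /S' /= image_set0.
- move=> x; have [|V SV xV] := Sx (set_val x); first exact: set_valP.
  exists (set_val @^-1` V); last exact: initial_continuous.
  by apply: Ssub SV _ => _ [z Vz <-].
exists (fun n => set_val @` V n) => // x Ux.
have : [set: set_type U] (SigSub (mem_set Ux)) by [].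
by rewrite -VT => -[n _ Vn]; exists n => //; exists (SigSub (mem_set Ux)).
Qed.

(** * Comparison of the notions of measurability *)

Section measurability.
Context {R : realType} {X : Type} {Y : uniformType}.
Context {F : set (set X)} {mu : set X -> \bar R} (f : X -> Y).
Hypothesis hmu : charge_space F mu.

Let hF : set_field F. Proof. by case: hmu. Qed.

(** A finite cover suffices for T2 measurability, since disjointifying it and
    removing the exceptional set N from it only shrinks the images under f. *)
Lemma T2_measurable_cover :
  (forall (eps : R) (E : set (Y * Y)), (0 < eps)%R -> entourage E ->
     exists N (L : seq (set X)),
       [/\ F N, mu N < eps%:E,
           forall A, A \in L -> F A /\ (f @` A) `*` (f @` A) `<=` E &
           setT `<=` N `|` \bigcup_(A in [set` L]) A]) ->
  T2_measurable F mu f.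
Proof.
move=> cover eps E eps0 entE.
have [N [L [FN ltN LP NL]]] := cover _ _ eps0 entE.
pose C n := nth set0 L n.
have CP n : F (C n) /\ (f @` C n) `*` (f @` C n) `<=` E.
  have [nL|Ln] := ltnP n (size L); first exact/LP/mem_nth.
  rewrite /C nth_default//; split; first exact: field_set0.
  by move=> [u v] [[]].
have FD n : F (seqDU C n).
  apply: field_setD => //; first by case: (CP n).
  by apply: field_bigsetU => // i; case: (CP i).
pose A k := if k is j.+1 then seqDU C j `\` N else N.
exists (size L), (fun i => A (val i)); split=> [| |[[|k] ltk]| |[[|k] ltk]] //=.
- move=> [[|i] lti] [[|j] ltj] _ _ /= [x []].
  + by move=> *; exact: val_inj.
  + by move=> Nx [_ /(_ Nx)].
  + by move=> [_ nNx] /nNx.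
  + move=> [Di _] [Dj _]; apply: val_inj; congr S.
    by apply: (@trivIset_seqDU _ C) => //; exists x.
- apply/seteqP; split=> // x _; have [Nx|nNx] := pselect (N x).
    by exists ord0.
  have [//|[B BL Bx]] := NL x Logic.I.
  have : (\bigcup_(i < size L) C i) x.
    by exists (index B L); rewrite /= ?index_mem// /C nth_index.
  rewrite bigcup_mkord bigsetU_seqDU -bigcup_mkord => -[i /= ltiL Dix].
  by exists (lift ord0 (Ordinal ltiL)).
- exact: field_setD.
- move=> _ [u v] /= [[x [[Cx _] _] <-] [x' [[Cx' _] _] <-]].
  by case: (CP k) => _; apply; split; [exists x|exists x'].
Qed.

(** The values s takes near those of f sort X into finitely many pieces, and
    on each piece f stays in a single section of the given entourage. *)
Lemma T1_T2_measurable : T1_measurable F mu f -> T2_measurable F mu f.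
Proof.
move=> T1; apply: T2_measurable_cover => eps E eps0 entE.
have [V entV VE] := entourage_small_sections entE.
have [s [/finite_seqP[r rs] Fs] /outer_charge_ltP[N [FN badN ltN]]] :=
  T1 _ _ eps0 entV.
exists N, [seq (s @^-1` [set b]) `\` N | b <- r]; split=> //.
- move=> _ /mapP[b _ ->]; split; first exact: field_setD.
  move=> [u v] /= [[x [sx nNx] <-] [x' [sx' nNx'] <-]].
  have near_b z : s z = b -> ~ N z -> xsection V b (f z).
    by move=> <- nNz; apply/xsectionP; apply: contrapT => /badN.
  by apply: (VE b); split; exact: near_b.
- move=> x _; have [Nx|nNx] := pselect (N x); [by left|right].
  exists (s @^-1` [set s x] `\` N) => //.
  rewrite /=; apply/mapP; exists (s x) => //.
  by have : range s (s x) by []; rewrite rs.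
Qed.

(** Conversely, s takes on each piece the value of f at one of its points. *)
Lemma T2_T1_measurable : T2_measurable F mu f -> T1_measurable F mu f.
Proof.
move=> T2 eps E eps0 entE.
have [n [A [tA AT FA ltA AE]]] := T2 _ _ eps0 entE.
have [[x0]|noX] := pselect (inhabited X); last first.
  have all0 (B : set X) : B = set0.
    by apply/seteqP; split=> // x; case: noX; exists.
  exists f; first split=> [|b].
  - by rewrite (all0 [set: X]) image_set0.
  - by rewrite (all0 (_ @^-1` _)); exact: field_set0.
  - apply/outer_charge_ltP; exists set0.
    split; [exact: field_set0|by move=> x; case: noX|by rewrite (charge_set0 hmu)].
have /choice[idx idxP] : forall x, exists i, A i x.
  by move=> x; have : setT x by []; rewrite -AT => -[i _ Aix]; exists i.
(* g i lies in A i as soon as A i is nonempty *)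
have /choice[g gP] : forall i, exists x, forall x', A i x' -> A i x.
  move=> i; have [[x Aix]|none] := pselect (exists x, A i x).
    by exists x.
  by exists x0 => x' Aix'; case: none; exists x'.
have idx_eq i x : A i x -> idx x = i by move=> Aix; apply: tA => //; exists x.
exists (f \o g \o idx); first split.
- apply: (@sub_finite_set _ _ ((f \o g) @` setT)); last exact: finite_image.
  by move=> _ [x _ <-]; exists (idx x).
- move=> b; rewrite (_ : _ @^-1` _ = \bigcup_(i in [set i | f (g i) = b]) A i).
    exact: (field_finite_bigcup hF finite_finset).
  apply/seteqP; split=> [x <-|x [i /= <- /idx_eq <-//]].
  by exists (idx x).
- apply/outer_charge_ltP; exists (A ord0); split=> // x /= nE.
  have [<-//|i0] := eqVneq (idx x) ord0; case: nE.
  apply: AE i0 _ _; split; [exists (g (idx x))|exists x] => //.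
  exact: gP (idxP x).
Qed.

Lemma T2_measurable_smooth : T2_measurable F mu f -> smooth F mu f.
Proof.
move=> T2 eps E eps0 entE.
have [n [A [tA AT FA ltA AE]]] := T2 _ _ eps0 entE.
exists n, (fun i => f @` A (lift ord0 i)); split=> [i|]; first exact: AE.
apply/outer_charge_ltP; exists (A ord0); split=> // x /= notB.
have : setT x by []; rewrite -AT => -[i _ Aix].
have [<-//|] := eqVneq i ord0; rewrite eq_sym => /unlift_some[j ij _].
by case: notB; exists j => //; exists x; rewrite -?ij.
Qed.

Lemma conventionally_uniformly_base_measurable :
  conventionally_measurable F f -> uniformly_base_measurable F mu f.
Proof.
move=> cm; exists [set E | entourage E /\ forall y, open (xsection E y)].
  split=> [E []//|E /entourage_open_sections[V entV [VE oV]]].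
  by exists V.
by move=> E y [_ oE]; apply: peano_jordan_field => //; exact: cm.
Qed.

Lemma conventionally_measurable_smooth : sigma_algebra setT F ->
  conventionally_measurable F f -> bounded_charge mu ->
  countably_additive F mu -> lindelof Y -> smooth F mu f.
Proof.
move=> sF cm bmu cmu lY eps E eps0 entE.
have [V entV VE] := entourage_small_sections entE.
have [W entW [WV oW]] := entourage_open_sections entV.
have [||U UP UT] := @lindelof_sequence_cover _
    [set U : set Y | open U /\ U `*` U `<=` E] lY.
- by split; [exact: open0|move=> [? ?] []].
- move=> y; exists (xsection W y); last exact: nbhs_entourage.
  split=> // -[u v] [/xsectionP yu /xsectionP yv].
  by apply: (VE y); split; apply/xsectionP; exact: WV.
have FU n : F (f @^-1` U n) by apply: cm; case: (UP n).
have fUT : \bigcup_n (f @^-1` U n) = setT by rewrite -preimage_bigcup UT.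
have [n ltn] := charge_small_tail hmu sF bmu cmu FU fUT eps0.
exists n, (fun i => U (val i)); split=> [i|]; first by case: (UP i).
apply/outer_charge_ltP; exists (~` \bigcup_(i < n) f @^-1` U i); split=> //.
  by apply/field_setC => //; rewrite bigcup_mkord; exact: field_bigsetU.
by move=> x /= nU [i /= lti Uix]; apply: nU; exists (Ordinal lti).
Qed.

(** The hypothesis covers the preimage of a neighbourhood of y by a member of F
    inside the preimage of U, up to arbitrarily small charge. By completeness the
    preimage of a smaller neighbourhood is then inside a member of F that is
    itself inside the preimage of U. Countably many of these members exhaust
    the preimage of U. *)
Lemma complete_conventionally_measurable :
  complete_measure_space F mu -> hereditarily_lindelof Y ->
  (forall (U : set Y) y, open U -> U y -> exists2 V, nbhs y V &
     forall eps : R, (0 < eps)%R -> exists M N,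
       [/\ F M, F N, mu N < eps%:E, f @^-1` V `<=` M `|` N &
           M `<=` f @^-1` U]) ->
  conventionally_measurable F f.
Proof.
move=> cX hlY approx U oU; have [[_ sF _] _] := cX.
pose S := [set V | exists G, [/\ F G, f @^-1` V `<=` G & G `<=` f @^-1` U]].
have [||y Uy|V SV UV] := @hereditarily_lindelof_sequence_cover _ U S hlY.
- by move=> V W [G [FG WG GU]] VW; exists G; split=> // x /VW /WG.
- by exists set0; split=> //; exact: field_set0.
- have [V yV VMN] := approx U y oU Uy.
  exists (U `&` V); last by apply: filterI => //; exact: open_nbhs_nbhs.
  have /choice[M MP] : forall m : nat, exists M, exists N,
      [/\ F M, F N, mu N < (m.+1%:R^-1 : R)%:E, f @^-1` V `<=` M `|` N &
          M `<=` f @^-1` U].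
    by move=> m; apply: VMN; rewrite invr_gt0.
  have FM : F (\bigcup_m M m).
    by apply: sigma_field_bigcup => // m; case: (MP m) => N [].
  have MU : \bigcup_m M m `<=` f @^-1` U.
    by move=> x [m _]; case: (MP m) => N [_ _ _ _]; exact.
  exists ((\bigcup_m M m) `|` (f @^-1` (U `&` V) `\` \bigcup_m M m)); split.
  + apply: field_setU => //; apply: (complete_small_cover hmu cX) => e e0.
    have [m _ /(_ m (leqnn m)) /= lt_e] := near_infty_natSinv_lt (PosNum e0).
    have [N [_ FN ltN VN _]] := MP m; exists N; split=> //; last first.
      by apply: lt_trans ltN _; rewrite lte_fin.
    by move=> x [[_ /VN[Mx|//]] nM]; case: nM; exists m.
  + by rewrite setUDr setDv setD0; exact: subsetUr.
  + by move=> x [/MU//|[[]]].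
have /choice[G GP] := SV.
rewrite (_ : f @^-1` U = \bigcup_n G n).
  by apply: sigma_field_bigcup => // n; case: (GP n).
apply/seteqP; split=> [x /UV[n _ Vn]|x [n _]].
  by exists n => //; case: (GP n) => _ + _; exact.
by case: (GP n) => _ _; exact.
Qed.

Lemma base_conventionally_measurable :
  complete_measure_space F mu -> hereditarily_lindelof Y ->
  base_measurable F mu f -> conventionally_measurable F f.
Proof.
move=> cX hlY bm; apply: complete_conventionally_measurable => // U y oU Uy.
have [B [By nbB] pB] := bm y.
have [|V BV VU] := nbB U; first exact: open_nbhs_nbhs.
exists V; first exact: By.
move=> eps /(pB V BV)[M [C [FM FC MV VC ltC]]].
exists M, (C `\` M); split=> //; first exact: field_setD.
- by move=> x /VC Cx; have [|] := pselect (M x); [left|right].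
- by move=> x /MV /VU.
Qed.

(** If W is so small that the union of the sets W[z] over z in W[y] is inside U,
    then the pieces of a partition adapted to W whose image meets W[y] cover
    the preimage of W[y] up to the exceptional piece, without leaving that
    of U. *)
Lemma T2_conventionally_measurable :
  complete_measure_space F mu -> hereditarily_lindelof Y ->
  T2_measurable F mu f -> conventionally_measurable F f.
Proof.
move=> cX hlY T2; apply: complete_conventionally_measurable => // U y oU Uy.
have [E entE EU] := nbhs_xsection (open_nbhs_nbhs (conj oU Uy)).
have entW := entourage_split_ent entE.
exists (xsection (split_ent E) y); first exact: nbhs_entourage.
move=> eps eps0; have [n [A [tA AT FA ltA AW]]] := T2 _ _ eps0 entW.
pose D := [set i | i != ord0 /\ exists2 x, A i x & split_ent E (y, f x)].
exists (\bigcup_(i in D) A i), (A ord0); split=> //.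
- exact: (field_finite_bigcup hF finite_finset).
- move=> x /xsectionP yx; have : setT x by []; rewrite -AT => -[i _ Aix].
  have [<-|i0] := eqVneq i ord0; [by right|left].
  by exists i => //; split=> //; exists x.
- move=> x [i [i0 [x' Aix' yx']] Aix]; apply/EU/xsectionP.
  apply: entourage_split yx' _ => //.
  by apply: AW i0 _ _; split; [exists x'|exists x].
Qed.

Lemma uniformly_base_base_measurable :
  uniformly_base_measurable F mu f -> base_measurable F mu f.
Proof.
move=> [B [Bent baseB] pB] y; exists [set xsection E y | E in B].
  split=> [_ [E BE <-]|N /nbhs_xsection[E /baseB[V BV VE] EN]].
    exact/nbhs_entourage/Bent.
  exists (xsection V y); first by exists V.
  by move=> z /xsectionP/VE/xsectionP/EN.
by move=> _ [E BE <-]; exact: pB.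
Qed.

(** Between W[y] and E[y], for W a small enough entourage, there is a compact
    set, the closure of W[y]. It is covered by finitely many basic
    neighbourhoods inside E[y], whose union serves as the new section. *)
Lemma base_uniformly_base_measurable : uniformly_locally_compact Y ->
  base_measurable F mu f -> uniformly_base_measurable F mu f.
Proof.
move=> [D entD cD] bm.
exists [set E | entourage E /\
    forall y, peano_jordan F mu (f @^-1` xsection E y)]; last by move=> E y [].
split=> [E []//|E entE].
have [V entV [VE oV]] := entourage_open_sections entE.
have entVD : entourage (V `&` D) by exact: filterI.
have entW := entourage_split_ent entVD.
have clW y :
    closure (xsection (split_ent (V `&` D)) y) `<=` xsection (V `&` D) y.
  exact: ent_closure.
have /choice[Q QP] : forall y, exists Q, [/\ peano_jordan F mu (f @^-1` Q),
    Q `<=` xsection E y & xsection (split_ent (V `&` D)) y `<=` Q].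
  move=> y.
  pose S := [set Q | peano_jordan F mu (f @^-1` Q) /\ Q `<=` xsection E y].
  have [||||Q [pQ QE] WQ] := @compact_directed_cover _
      (closure (xsection (split_ent (V `&` D)) y)) S.
  - apply: (subclosed_compact _ (cD y)); first exact: closed_closure.
    by move=> z /clW/xsectionP[_ Dz]; exact/xsectionP.
  - split; last exact: sub0set.
    by rewrite preimage_set0; apply: peano_jordan_field => //; exact: field_set0.
  - move=> P Q [pP PE] [pQ QE]; split; last by rewrite subUset.
    by rewrite preimage_setU; exact: peano_jordanU.
  - move=> z /clW/xsectionP[Vz _].
    have [B [Bz nbB] pB] := bm z.
    have [|P BP PV] := nbB (xsection V y).
      by apply: open_nbhs_nbhs; split=> //; exact/xsectionP.
    exists P; last exact: Bz.
    by split; [exact: pB|move=> w /PV/xsectionP/VE/xsectionP].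
  - by exists Q; split=> // z Wz; apply/WQ/subset_closure.
exists [set p | Q p.1 p.2].
  split=> [|y].
    apply: (filterS _ entW) => -[y z] Wyz.
    by have [_ _] := QP y; apply; exact/xsectionP.
  rewrite (_ : xsection _ y = Q y); first by case: (QP y).
  by apply/seteqP; split=> z; rewrite xsectionP.
by move=> [y z] /= Qz; apply/xsectionP; case: (QP y) => _ + _; exact.
Qed.

(** Each of the n small sets that smoothness provides is inside the section G[y]
    at any of its points y, and the preimage of G[y] is approximated from inside
    by some C in F. With an error below eps / 2(n + 1) in each approximation,
    the sets C together miss less than eps of X. *)
Lemma smooth_T2_measurable :
  uniformly_base_measurable F mu f -> smooth F mu f -> T2_measurable F mu f.
Proof.
move=> [B [Bent baseB] pB] sm; apply: T2_measurable_cover => eps E eps0 entE.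
have [V entV VE] := entourage_small_sections entE.
have [G BG GV] := baseB _ entV.
have eps20 : (0 < eps / 2)%R by rewrite divr_gt0.
have [n [P [PG /outer_charge_ltP[N [FN PN ltN]]]]] := sm _ _ eps20 (Bent _ BG).
pose d : R := (eps / 2 / n.+1%:R)%R.
have d0 : (0 < d)%R by rewrite divr_gt0.
have /choice[C /choice[H CHP]] : forall i, exists C, exists H,
    [/\ F C /\ F H, f @^-1` P i `<=` H,
        (f @` C) `*` (f @` C) `<=` E & mu (H `\` C) < d%:E].
  move=> i; have [[y Py]|P0] := pselect (exists y, P i y); last first.
    exists set0, set0; split.
    - by split; exact: field_set0.
    - by move=> x Px; apply: P0; exists (f x).
    - by move=> [u v] [[]].
    - by rewrite setDv (charge_set0 hmu).
  have [C [H [FC FH CG GH ltd]]] := pB G y BG _ d0.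
  exists C, H; split=> //.
    by move=> x Px; apply/GH/xsectionP; exact: (PG i (y, f x)).
  move=> [u v] /= [[x /CG Gx <-] [x' /CG Gx' <-]].
  have GVy z : xsection G y z -> xsection V y z.
    by move=> /xsectionP/GV/xsectionP.
  by apply: (VE y); split; exact: GVy.
have FHC i : F (H i `\` C i) by case: (CHP i) => -[? ? _ _ _]; exact: field_setD.
have le_muHC : mu (\big[setU/set0]_(i < n) (H i `\` C i)) <= (eps / 2)%:E.
  apply: le_trans (charge_bigsetU_le hmu _ FHC) _.
  apply: (@le_trans _ _ (\sum_(i < n) d%:E)).
    by apply: lee_sum => i _; case: (CHP i) => _ _ _ /ltW.
  rewrite sumEFin lee_fin sumr_const card_ord -(mulr_natl d) /d mulrCA.
  by rewrite ger_pMr// ler_pdivrMr// mul1r ler_nat.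
exists (N `|` \big[setU/set0]_(i < n) (H i `\` C i)), [seq C i | i : 'I_n].
split=> //.
- by apply: field_setU => //; exact: field_bigsetU.
- apply: le_lt_trans (charge_setU_le hmu FN _) _; first exact: field_bigsetU.
  apply: (le_lt_trans (leeD (lexx (mu N)) le_muHC)).
  by rewrite [in ltRHS](splitr eps) EFinD lteD2rE.
- by move=> _ /mapP[i _ ->]; case: (CHP i) => -[].
- move=> x _; have [[i _ Px]|nPx] := pselect ((\bigcup_i P i) (f x)); last first.
    by left; left; exact: PN.
  have [Cx|nCx] := pselect (C i x).
    by right; exists (C i) => //=; exact/map_f/mem_enum.
  left; right; rewrite -bigcup_pred; exists i => //.
  by split=> //; case: (CHP i) => _ + _ _; exact.
Qed.

End measurability.

Theorem theorem2p2 (R : realType) (X : Type) (F : set (set X))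
    (mu : set X -> \bar R) (Y : uniformType) (f : X -> Y)
    (hmu : charge_space F mu) :
  (* 1 *)
  ((T1_measurable F mu f <-> T2_measurable F mu f) /\
   (T1_measurable F mu f \/ T2_measurable F mu f -> smooth F mu f)) /\
  (* 2 *)
  (sigma_algebra setT F -> conventionally_measurable F f ->
     uniformly_base_measurable F mu f /\
     (bounded_charge mu -> countably_additive F mu -> lindelof Y ->
        T2_measurable F mu f)) /\
  (* 3 *)
  (complete_measure_space F mu -> hereditarily_lindelof Y ->
     base_measurable F mu f \/ T2_measurable F mu f ->
     conventionally_measurable F f) /\
  (* 4 *)
  ((uniformly_base_measurable F mu f -> base_measurable F mu f) /\
   (uniformly_locally_compact Y ->
      base_measurable F mu f -> uniformly_base_measurable F mu f)) /\
  (* 5 *)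
  (uniformly_base_measurable F mu f -> smooth F mu f -> T2_measurable F mu f).
Proof.
split; [split; [split|]|split; [|split; [|split; [split|]]]].
- exact: T1_T2_measurable.
- exact: T2_T1_measurable.
- by case=> [/(T1_T2_measurable hmu)|]; exact: T2_measurable_smooth.
- move=> sF cm; have ubm := conventionally_uniformly_base_measurable hmu cm.
  split=> // bmu cmu lY; apply: smooth_T2_measurable => //.
  exact: conventionally_measurable_smooth.
- move=> cX hlY [bm|T2].
    exact: (base_conventionally_measurable hmu cX hlY bm).
  exact: (T2_conventionally_measurable hmu cX hlY T2).
- exact: uniformly_base_base_measurable.
- exact: base_uniformly_base_measurable.
- exact: smooth_T2_measurable.
Qed.
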